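(* The functor $\mathcal{E}\mathrm{nds}(-):\mathbf{PGeo}^{\mathrm{Crs}}\to\mathbf{Set}$ maps coarse homotopic morphisms to equal maps, and thus maps coarse homotopy equivalences to bijections.
   Context: A metric space is proper if its closed bounded subsets are exactly its compact subsets. A metric space $X$ is geodesic if any $x,x'\in X$ are joined by a geodesic, i.e. an isometric embedding $u_{x,x'}:[0,a_{x,x'}]\to X$ with $a_{x,x'}=d_X(x,x')$, $u_{x,x'}(0)=x$, $u_{x,x'}(a_{x,x'})=x'$. A map $f:X\to Y$ of metric spaces is controlled if for every $R>0$ there is $S>0$ such that $d_X(x,x')<R$ implies $d_Y(f(x),f(x'))<S$; (metrically) proper if preimages of bounded sets are bounded; coarse if both. $\mathbf{PGeo}^{\mathrm{Crs}}$ is the category of proper geodesic metric spaces and coarse maps. Functor $\mathcal{E}\mathrm{nds}$: for proper $X$, two metrically proper continuous maps (rays) $r,r':\mathbb{R}_{\ge0}\to X$ are equivalent if for every bounded $B\subseteq X$ there is $t\ge0$ such that $r([t,\infty))$ and $r'([t,\infty))$ lie in the same path component of $X\setminus B$. $\mathcal{E}\mathrm{nds}(X)$ is the set of classes $\mathrm{end}(r)$ of metrically proper continuous rays $r$. For any map $r:\mathbb{R}_{\ge0}\to X$ to a geodesic space, $r^*$ is the continuous map $r^*(h)=u_{r(\lfloor h\rfloor),r(\lceil h\rceil)}\big(a_{r(\lfloor h\rfloor),r(\lceil h\rceil)}(h-\lfloor h\rfloor)\big)$ for a choice of geodesics. The functor $\mathcal{E}\mathrm{nds}(-)$ sends $X$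 to $\mathcal{E}\mathrm{nds}(X)$ and a coarse map $f:X\to Y$ to the function $f_{\mathcal{E}}:\mathcal{E}\mathrm{nds}(X)\to\mathcal{E}\mathrm{nds}(Y)$, $\mathrm{end}(r)\mapsto\mathrm{end}((f\circ r)^* )$. Coarse homotopy: for a coarse map $q:X\to\mathbb{R}_{\ge0}$, let $I_qX=\{(x,t)\in X\times\mathbb{R}_{\ge0}:t\le q(x)\}$ with the restriction of the max product metric. Coarse maps $f,g:X\to Y$ are coarse homotopic if there are coarse maps $q:X\to\mathbb{R}_{\ge0}$ and $H:I_qX\to Y$ with $H(x,0)=f(x)$, $H(x,q(x))=g(x)$ for all $x$. A coarse map $f:X\to Y$ is a coarse homotopy equivalence if there is a coarse map $g:Y\to X$ with $g\circ f$ coarse homotopic to $1_X$ and $f\circ g$ coarse homotopic to $1_Y$.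
   Formalization: The rule end(r) ↦ end((f∘r)^* ) is undefined for some continuous proper rays r, as (f∘r)^* may fail to be metrically proper (e.g. f the identity of the plane, r(n)=((-1)^n n,0)); the formal f_E applies it to a coarse representative, which every end has, and agrees with it whenever it makes sense. *)

(* Defs.v *)
From HB Require Import structures.
From mathcomp Require Import all_boot all_order all_algebra generic_quotient.
From mathcomp Require Import zify ring lra.
From mathcomp Require Import all_classical all_reals all_analysis.

Set Implicit Arguments.
Unset Strict Implicit.
Unset Printing Implicit Defensive.

Import Order.TTheory GRing.Theory Num.Theory.
Import numFieldNormedType.Exports.

Local Open Scope classical_set_scope.
Local Open Scope ring_scope.
Local Open Scope quotient_scope.

(* Subspaces (as subtypes) and products (with the max metric) of metric
   spaces, on top of the topologies of the library. *)
Section metric_set_type.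
Context {R : realType} {X : metricType R} (A : set X).

Let dist (a b : A) : R := mdist (\val a) (\val b).

Let dist_ge0 a b : 0 <= dist a b. Proof. exact: mdist_ge0. Qed.

Let dist_positivity a b : dist a b = 0 -> a = b.
Proof. by move=> /mdist_positivity; apply: val_inj. Qed.

Let ball_dist (a : A) d : ball a d = [set b | dist a b < d].
Proof. by rewrite -initial_ballE ballEmdist. Qed.

HB.instance Definition _ :=
  PseudoMetric_isMetric.Build R (A : Type) dist_ge0 dist_positivity ball_dist.

End metric_set_type.

Section metric_prod.
Context {R : realType} {X Y : metricType R}.

Let dist (a b : X * Y) : R := Num.max (mdist a.1 b.1) (mdist a.2 b.2).

Let dist_ge0 a b : 0 <= dist a b.
Proof. by rewrite le_max mdist_ge0. Qed.

Let dist_positivity a b : dist a b = 0 -> a = b.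
Proof.
case: a b => [a1 a2] [b1 b2] d0.
have : dist (a1, a2) (b1, b2) <= 0 by rewrite d0.
rewrite ge_max /= => /andP[d1 d2].
by congr pair; apply: mdist_positivity; apply/le_anti; rewrite mdist_ge0 andbT.
Qed.

Let ball_dist (a : X * Y) d : ball a d = [set b | dist a b < d].
Proof.
apply/seteqP; split => b; rewrite /ball /= /prod_ball /dist gt_max !ballEmdist.
  by case=> /= -> ->.
by move=> /andP[].
Qed.

HB.instance Definition _ :=
  PseudoMetric_isMetric.Build R (X * Y)%type dist_ge0 dist_positivity ball_dist.

End metric_prod.

Definition Rge0 (R : realType) : Type := set_type [set x : R^o | 0 <= x].

Definition rval (R : realType) (h : Rge0 R) : R := \val h.

Lemma Rge0_ge0 (R : realType) (h : Rge0 R) : 0 <= rval h.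
Proof. by have := set_valP h. Qed.

Definition to_Rge0 (R : realType) (x : R) (x0 : 0 <= x) : Rge0 R :=
  exist _ (x : R^o) (mem_set x0).

Section coarse_notions.
Context {R : realType}.
Implicit Types X Y : metricType R.

Definition mbounded X (A : set X) : Prop :=
  exists M : R, forall x y, A x -> A y -> mdist x y <= M.

Definition proper_space X : Prop :=
  forall A : set X, closed A /\ mbounded A <-> compact A.

(* The geodesic [u] is only constrained on the segment [[0, mdist x y]]. *)
Definition is_geodesic X (x y : X) (u : R -> X) : Prop :=
  [/\ u 0 = x, u (mdist x y) = y &
      {in `[0, mdist x y] &, forall s t, mdist (u s) (u t) = `|s - t|}].

Definition geodesic_space X : Prop :=
  forall x y : X, exists u : R -> X, is_geodesic x y u.

Definition geodesic_choice X (u : X -> X -> R -> X) : Prop :=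
  forall x y, is_geodesic x y (u x y).

Definition controlled X Y (f : X -> Y) : Prop :=
  forall r : R, 0 < r -> exists2 s : R, 0 < s &
    forall x y, mdist x y < r -> mdist (f x) (f y) < s.

Definition metrically_proper X Y (f : X -> Y) : Prop :=
  forall B : set Y, mbounded B -> mbounded (f @^-1` B).

Definition coarse X Y (f : X -> Y) : Prop :=
  controlled f /\ metrically_proper f.

Definition path_joined X (A : set X) (x y : X) : Prop :=
  exists g : R -> X, [/\ {within `[0, 1], continuous g},
    g @` `[0, 1] `<=` A, g 0 = x & g 1 = y].

Definition is_path_component X (A C : set X) : Prop :=
  exists2 x, A x & C = [set y | path_joined A x y].

End coarse_notions.

HB.mixin Record isProperGeodesic (R : realType) X & Metric R X := {
  pgeo_proper : proper_space X;
  pgeo_geodesic : geodesic_space X }.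

#[short(type="pgeoType")]
HB.structure Definition PGeo (R : realType) :=
  { X of Metric R X & isProperGeodesic R X }.

Record coarseMap (R : realType) (X Y : metricType R) := CoarseMap {
  coarse_fun :> X -> Y;
  coarse_funP : coarse coarse_fun }.

Record ray (R : realType) (X : metricType R) := Ray {
  ray_fun :> Rge0 R -> X;
  ray_continuous : continuous ray_fun;
  ray_proper : metrically_proper ray_fun }.

HB.instance Definition _ (R : realType) (X : metricType R) :=
  gen_eqMixin (ray X).
HB.instance Definition _ (R : realType) (X : metricType R) :=
  gen_choiceMixin (ray X).

Definition tail (R : realType) (X : metricType R) (r : Rge0 R -> X) (t : R) :
  set X := r @` [set h | t <= rval h].

Definition ray_equiv (R : realType) (X : metricType R) (r r' : ray X) : Prop :=
  forall B : set X, mbounded B -> exists2 t : R, 0 <= t &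
    exists2 C, is_path_component (~` B) C & tail r t `<=` C /\ tail r' t `<=` C.

Section star.
Context {R : realType} {X : metricType R}.
Implicit Types h : Rge0 R.

Lemma floor_subproof h : 0 <= (Num.floor (rval h))%:~R :> R.
Proof. by rewrite ler0z floor_ge0 Rge0_ge0. Qed.

Lemma ceil_subproof h : 0 <= (Num.ceil (rval h))%:~R :> R.
Proof.
rewrite ler0z -(ler0z R); apply: le_trans (Rge0_ge0 h) _; exact: ceil_ge.
Qed.

Definition Rge0_floor h : Rge0 R := to_Rge0 (floor_subproof h).
Definition Rge0_ceil h : Rge0 R := to_Rge0 (ceil_subproof h).

Definition star (u : X -> X -> R -> X) (r : Rge0 R -> X) h : X :=
  let x := r (Rge0_floor h) in
  let y := r (Rge0_ceil h) in
  u x y (mdist x y * (rval h - rval (Rge0_floor h))).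

End star.

Section paths.
Context {R : realType} {X : metricType R}.
Implicit Types (A : set X) (g : R -> X).

Lemma within_segmentP (a b : R) g : {within `[a, b], continuous g} <->
  forall s, s \in `[a, b] -> forall e : R, 0 < e -> exists2 d : R, 0 < d &
    forall t, t \in `[a, b] -> `|s - t| < d -> mdist (g s) (g t) < e.
Proof.
rewrite subspace_continuousP; split=> gc s sab.
  move=> e e0.
  have /metricType_numDomainType.cvgrPdist_lt/(_ _ e0) := gc s sab.
  rewrite near_withinE /= => /nbhs_ballP[d /= d0 sd].
  by exists d => // t tab std; apply: (sd t).
apply/metricType_numDomainType.cvgrPdist_lt => e e0.
have [d d0 sd] := gc s sab e e0.
rewrite near_withinE; apply/nbhs_ballP; exists d => //= t std tab.
exact: sd.
Qed.

Lemma segment_unif_continuous (a b : R) g : {within `[a, b], continuous g} ->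
  forall e : R, 0 < e -> exists2 d : R, 0 < d &
    forall s t, s \in `[a, b] -> t \in `[a, b] -> `|s - t| < d ->
      mdist (g s) (g t) < e.
Proof.
move=> /within_segmentP gc e e0.
have := @segment_compact R a b; rewrite compact_near_coveringP.
move=> /(_ R (0 : R)^'+ (fun d s => s \in `[a, b] ->
   forall t, t \in `[a, b] -> `|s - t| < d -> mdist (g s) (g t) < e)).
case; last first.
  move=> d /= d0 dP; exists (d / 2); first by rewrite divr_gt0.
  move=> s t sab tab std; apply: (dP (d / 2)) => //=.
    by rewrite sub0r normrN gtr0_norm; lra.
  by rewrite divr_gt0.
move=> s sab.
have [d d0 sd] := gc s sab (e / 2) ltac:(by rewrite divr_gt0).
exists (ball s (d / 2), [set x | x < d / 2]).
  split; first by apply: nbhsx_ballx; rewrite divr_gt0.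
  by apply: nbhs_right_lt; rewrite divr_gt0.
move=> [s' d'] /= [ss' dd'] s'ab t tab s't; rewrite /ball /= in ss'.
have -> : e = e / 2 + e / 2 by lra.
apply: (le_lt_trans (metric_triangle _ (g s) _)); apply: ltrD.
  by rewrite metric_sym; apply: sd => //; lra.
apply: sd => //.
apply: (le_lt_trans (ler_distD s' _ _)); lra.
Qed.

Lemma path_joined_segment A (a b : R) g : a <= b ->
  {within `[a, b], continuous g} ->
  (forall t, t \in `[a, b] -> A (g t)) -> path_joined A (g a) (g b).
Proof.
move=> ab /within_segmentP gc gA.
have abP t : t \in `[(0 : R), 1] -> a + t * (b - a) \in `[a, b].
  rewrite !in_itv /= => /andP[t0 t1]; apply/andP; split; nra.
exists (fun t => g (a + t * (b - a))); split.
- apply/within_segmentP => s s01 e e0.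
  have [d d0 sd] := gc _ (abP s s01) e e0.
  have k0 : 0 < b - a + 1 by lra.
  exists (d / (b - a + 1)); first by rewrite divr_gt0.
  move=> t t01; rewrite ltr_pdivlMr // => st; apply: sd; first exact: abP.
  rewrite [X in `|X|](_ : _ = (s - t) * (b - a)); last by ring.
  rewrite normrM (ger0_norm (_ : 0 <= b - a)); last by lra.
  have := normr_ge0 (s - t); nra.
- by move=> _ [t t01 <-]; apply/gA/abP.
- by congr g; ring.
- by congr g; ring.
Qed.

Lemma path_joined_refl A x : A x -> path_joined A x x.
Proof.
move=> Ax; apply: (@path_joined_segment A 0 1 (cst x)) => //.
by apply/within_segmentP => s _ e e0; exists 1 => // *; rewrite mdistxx.
Qed.

Lemma path_joined_sym A x y : path_joined A x y -> path_joined A y x.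
Proof.
move=> [g [/within_segmentP gc gA g0 g1]].
have revP t : t \in `[(0 : R), 1] -> 1 - t \in `[(0 : R), 1].
  rewrite !in_itv /= => /andP[t0 t1]; apply/andP; split; lra.
exists (fun t => g (1 - t)); split.
- apply/within_segmentP => s s01 e e0.
  have [d d0 sd] := gc _ (revP s s01) e e0; exists d => // t t01 st.
  apply: sd; first exact: revP.
  by rewrite [X in `|X|](_ : _ = t - s) 1?distrC//; ring.
- by move=> _ [t t01 <-]; apply: gA; exists (1 - t) => //; apply: revP.
- by rewrite subr0.
- by rewrite subrr.
Qed.

Lemma path_joined_trans A y x z :
  path_joined A x y -> path_joined A y z -> path_joined A x z.
Proof.
move=> [g [/within_segmentP gc gA g0 g1]] [k [/within_segmentP kc kA k0 k1]].
pose c (t : R) := if t <= 1 then g t else k (t - 1).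
have c1 (t : R) : 1 <= t -> c t = k (t - 1).
  rewrite le_eqVlt => /orP[/eqP <-|t1].
    by rewrite /c lexx g1 subrr.
  by rewrite /c leNgt t1.
have -> : x = c 0 by rewrite /c ler01.
have -> : z = c 2 by rewrite c1 -?k1; [congr k; ring|lra].
apply: path_joined_segment; first by [].
  have -> : [set` `[(0 : R), 2]] = `[0, 1] `|` `[1, 2].
    apply/seteqP; split=> t /=; rewrite !in_itv /=.
      move=> /andP[t0 t2]; have [t1|t1] := leP t 1; [left|right]; lra.
    by case=> /andP[ta tb]; apply/andP; split; lra.
  apply: withinU_continuous; try exact: interval_closed.
    apply/within_segmentP => s s01 e e0; have [d d0 sd] := gc s s01 e e0.
    exists d => // t t01 st; rewrite /c.
    by move: (s01) (t01); rewrite !in_itv /= => /andP[_ ->] /andP[_ ->]; apply: sd.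
  have kP t : t \in `[(1 : R), 2] -> t - 1 \in `[(0 : R), 1].
    by rewrite !in_itv /= => /andP[? ?]; apply/andP; split; lra.
  apply/within_segmentP => s s01 e e0; have [d d0 sd] := kc _ (kP s s01) e e0.
  exists d => // t t01 st; rewrite !c1.
  - apply: sd; first exact: kP.
    by rewrite [X in `|X|](_ : _ = s - t) //; ring.
  - by move: t01; rewrite in_itv => /andP[].
  - by move: s01; rewrite in_itv => /andP[].
move=> t; rewrite in_itv /= => /andP[t0 t2].
have [t1|t1] := leP t 1.
  by rewrite /c t1; apply: gA; exists t => //=; rewrite in_itv /= t0.
rewrite c1 ?ltW //; apply: kA; exists (t - 1) => //=.
by rewrite in_itv /=; apply/andP; split; lra.
Qed.

Lemma path_joined_sub A x y : path_joined A x y -> A x /\ A y.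
Proof.
move=> [g [_ gA <- <-]]; split; apply: gA; [exists 0|exists 1] => //=;
  by rewrite in_itv /= ?lexx ?ler01.
Qed.

Lemma path_joined_mono A A' x y : A `<=` A' ->
  path_joined A x y -> path_joined A' x y.
Proof. by move=> AA' [g [gc gA g0 g1]]; exists g; split=> // z /gA/AA'. Qed.

End paths.

Section Rge0_theory.
Context {R : realType}.
Implicit Types h : Rge0 R.

Lemma to_Rge0K (x : R) (x0 : 0 <= x) : rval (to_Rge0 x0) = x.
Proof. by []. Qed.

Lemma rval_inj : injective (@rval R).
Proof. by move=> h h' hh'; apply: val_inj. Qed.

Lemma mdist_Rge0 h h' : mdist h h' = `|rval h - rval h'|.
Proof. by rewrite distrC. Qed.

Definition nat_Rge0 (n : nat) : Rge0 R := to_Rge0 (ler0n R n).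

Definition clamp (x : R) : Rge0 R.
Proof. by apply: (@to_Rge0 _ (Num.max 0 x)); rewrite le_max lexx. Defined.

Lemma clampE (x : R) : 0 <= x -> rval (clamp x) = x.
Proof. by move=> x0; rewrite to_Rge0K max_r. Qed.

Lemma clampK h : clamp (rval h) = h.
Proof. by apply: rval_inj; rewrite clampE // Rge0_ge0. Qed.

Lemma Rge0_floorE h (n : nat) : n%:R <= rval h < n.+1%:R ->
  Rge0_floor h = nat_Rge0 n.
Proof.
move=> nh; apply: rval_inj; rewrite !to_Rge0K.
rewrite (@floor_def _ _ n) // intrD.
by move: nh; rewrite -natr1.
Qed.

Lemma Rge0_ceilE h (n : nat) : n%:R < rval h <= n.+1%:R ->
  Rge0_ceil h = nat_Rge0 n.+1.
Proof.
move=> nh; apply: rval_inj; rewrite !to_Rge0K.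
by rewrite (@ceil_def _ _ n.+1) // intS addrC addKr.
Qed.

Lemma Rge0_ceil_nat (n : nat) : Rge0_ceil (nat_Rge0 n) = nat_Rge0 n.
Proof.
apply: rval_inj; rewrite !to_Rge0K.
rewrite (@ceil_def _ _ n) // lexx andbT intrB -pmulrn.
by rewrite ltrBlDr ltrDl.
Qed.

Lemma Rge0_floor_nat (n : nat) : Rge0_floor (nat_Rge0 n) = nat_Rge0 n.
Proof. by apply: Rge0_floorE; rewrite lexx ltr_nat /=. Qed.

Lemma Rge0_floor_is_nat h : exists n : nat, Rge0_floor h = nat_Rge0 n.
Proof. by exists (Num.truncn (rval h)); apply/Rge0_floorE/truncn_itv/Rge0_ge0. Qed.

Lemma Rge0_ceil_is_nat h : exists n : nat, Rge0_ceil h = nat_Rge0 n.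
Proof.
have /andP[] := truncn_itv (Rge0_ge0 h).
set n := Num.truncn _; rewrite le_eqVlt => /predU1P[nh _|nh hn].
  exists n; rewrite -Rge0_ceil_nat; congr Rge0_ceil; apply: rval_inj.
  by rewrite to_Rge0K.
by exists n.+1; apply: Rge0_ceilE; rewrite nh ltW.
Qed.

Lemma continuous_Rge0P (X : metricType R) (r : Rge0 R -> X) : continuous r <->
  forall h (e : R), 0 < e -> exists2 d : R, 0 < d &
    forall h', `|rval h - rval h'| < d -> mdist (r h) (r h') < e.
Proof.
split=> rc h.
  move=> e e0.
  have /metricType_numDomainType.cvgrPdist_lt/(_ _ e0) := rc h.
  move=> /nbhs_ballP[d /= d0 sd]; by exists d.
have FF : Filter (nbhs (h : Rge0 R)) by apply: nbhs_filter.
apply: (@metricType_numDomainType.cvgrPdist_lt R X (Rge0 R) _ FF r (r h)).2.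
move=> e e0.
have [d d0 sd] := rc h e e0.
apply/nbhs_ballP; exists d => //= h'; rewrite ballEmdist /= mdist_Rge0; exact: sd.
Qed.

Lemma within_clamp (X : metricType R) (r : Rge0 R -> X) (a b : R) :
  continuous r -> 0 <= a -> {within `[a, b], continuous (r \o clamp)}.
Proof.
move=> /continuous_Rge0P rc a0; apply/within_segmentP => s sab e e0.
have [d d0 sd] := rc (clamp s) e e0; exists d => // t tab st; apply: sd.
by move: sab tab; rewrite !in_itv /= => /andP[? _] /andP[? _]; rewrite !clampE; lra.
Qed.

Lemma path_joined_ray (X : metricType R) (r : Rge0 R -> X) (A : set X) h h' :
  continuous r -> rval h <= rval h' ->
  (forall k, rval h <= rval k <= rval h' -> A (r k)) ->
  path_joined A (r h) (r h').
Proof.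
move=> rc hh' rA.
have := @path_joined_segment _ _ A _ _ _ hh' (within_clamp rc (Rge0_ge0 h)).
rewrite /= !clampK; apply => t; rewrite in_itv /= => ht.
by apply: rA; rewrite clampE //; have := Rge0_ge0 h; lra.
Qed.

Lemma metrically_proper_tail (X : metricType R) (r : Rge0 R -> X) (B : set X) :
  metrically_proper r -> mbounded B ->
  exists n : nat, forall h, n%:R <= rval h -> ~ B (r h).
Proof.
move=> rp /rp[M BM].
have [[h0 Bh0]|noB] := pselect (exists h, B (r h)); last first.
  by exists 0%N => h _ Bh; apply: noB; exists h.
exists (Num.truncn (rval h0 + M)).+1 => h nh Bh.
have := BM h h0 Bh Bh0; rewrite mdist_Rge0 => hM.
have := truncnS_gt (rval h0 + M); have := ler_norm (rval h - rval h0); lra.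
Qed.

Lemma tail_metrically_proper (X : metricType R) (r : Rge0 R -> X) :
  (forall B : set X, mbounded B ->
    exists n : nat, forall h, n%:R <= rval h -> ~ B (r h)) ->
  metrically_proper r.
Proof.
move=> rB B /rB[n nB]; exists n%:R => h h' Bh Bh'; rewrite mdist_Rge0.
have hn : rval h < n%:R by rewrite ltNge; apply/negP => /nB.
have hn' : rval h' < n%:R by rewrite ltNge; apply/negP => /nB.
have := Rge0_ge0 h; have := Rge0_ge0 h'.
by rewrite ler_norml => *; apply/andP; split; lra.
Qed.

End Rge0_theory.

Section ray_equiv_theory.
Context {R : realType} {X : metricType R}.
Implicit Types (r : ray X) (B : set X) (h : Rge0 R).

Lemma ray_equivP r r' : (forall B, mbounded B -> exists h h' : Rge0 R,
    [/\ forall k, rval h <= rval k -> ~ B (r k),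
        forall k, rval h' <= rval k -> ~ B (r' k) &
        path_joined (~` B) (r h) (r' h')]) -> ray_equiv r r'.
Proof.
move=> rr' B /rr'[h [h' [rB r'B pB]]].
exists (Num.max (rval h) (rval h')); first by rewrite le_max Rge0_ge0.
exists [set y | path_joined (~` B) (r h) y].
  by exists (r h) => //; apply: rB.
split=> _ [k + <-] /=; rewrite /mkset ge_max => /andP[hk h'k].
  apply: path_joined_ray => // [|j /andP[/rB //]].
  exact: ray_continuous.
apply: (path_joined_trans pB).
apply: path_joined_ray => // [|j /andP[/r'B //]].
exact: ray_continuous.
Qed.

Lemma ray_equiv_joined r r' : ray_equiv r r' -> forall B, mbounded B ->
  exists n : nat, forall h h', n%:R <= rval h -> n%:R <= rval h' ->
    path_joined (~` B) (r h) (r' h').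
Proof.
move=> rr' B /rr'[t t0 [_ [x xB ->] [rC r'C]]].
exists (Num.truncn t).+1 => h h' nh nh'.
have := truncnS_gt t => tn.
apply: (@path_joined_trans _ _ _ x).
  by apply/path_joined_sym/rC; exists h => //=; lra.
by apply: r'C; exists h' => //=; lra.
Qed.

Lemma ray_equiv_refl r : ray_equiv r r.
Proof.
apply: ray_equivP => B bB; have [n nB] := metrically_proper_tail (@ray_proper _ _ r) bB.
exists (nat_Rge0 n), (nat_Rge0 n); split=> //.
by apply: path_joined_refl; apply: nB; rewrite to_Rge0K.
Qed.

Lemma ray_equiv_sym r r' : ray_equiv r r' -> ray_equiv r' r.
Proof.
move=> rr' B /rr'[t t0 [C Cc [rC r'C]]]; exists t => //; exists C => //.
Qed.

Lemma ray_equiv_trans r r' r'' :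
  ray_equiv r r' -> ray_equiv r' r'' -> ray_equiv r r''.
Proof.
move=> /ray_equiv_joined rr' /ray_equiv_joined r'r''.
apply: ray_equivP => B bB.
have [n nB] := rr' B bB; have [m mB] := r'r'' B bB.
have le_max k : (maxn n m)%:R <= rval k -> n%:R <= rval k :> R /\ m%:R <= rval k :> R.
  by move=> nk; split; apply: le_trans nk; rewrite ler_nat ?leq_maxl ?leq_maxr.
pose N := @nat_Rge0 R (maxn n m).
have [nN mN] : n%:R <= rval N :> R /\ m%:R <= rval N :> R by apply: le_max.
exists N, N; split.
- by move=> k /le_max[nk mk]; have [] := path_joined_sub (nB k k nk nk).
- by move=> k /le_max[nk mk]; have [] := path_joined_sub (mB k k mk mk).
- exact: path_joined_trans (nB N N nN nN) (mB N N mN mN).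
Qed.

End ray_equiv_theory.

Section star_theory.
Context {R : realType} {X : metricType R}.
Variable u : X -> X -> R -> X.
Hypothesis uP : geodesic_choice u.
Implicit Types (p : Rge0 R -> X) (h : Rge0 R).

Let a p (n : nat) : R := mdist (p (nat_Rge0 n)) (p (nat_Rge0 n.+1)).

Let truncP h : (Num.truncn (rval h))%:R <= rval h < (Num.truncn (rval h)).+1%:R.
Proof. exact/truncn_itv/Rge0_ge0. Qed.

Lemma star_nat p (n : nat) : star u p (nat_Rge0 n) = p (nat_Rge0 n).
Proof.
rewrite /star Rge0_floor_nat Rge0_ceil_nat subrr mulr0.
by have [] := uP (p (nat_Rge0 n)) (p (nat_Rge0 n)).
Qed.

Lemma star_segment p (n : nat) h : n%:R <= rval h <= n.+1%:R ->
  star u p h =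
  u (p (nat_Rge0 n)) (p (nat_Rge0 n.+1)) (a p n * (rval h - n%:R)).
Proof.
have [u0 u1 _] := uP (p (nat_Rge0 n)) (p (nat_Rge0 n.+1)).
rewrite le_eqVlt => /andP[/predU1P[nh _|nh]].
  have -> : h = nat_Rge0 n by apply: rval_inj; rewrite to_Rge0K.
  by rewrite star_nat to_Rge0K subrr mulr0 u0.
rewrite le_eqVlt => /predU1P[hn|hn].
  have -> : h = nat_Rge0 n.+1 by apply: rval_inj; rewrite to_Rge0K.
  rewrite star_nat to_Rge0K -(natr1 n) addrAC subrr add0r mulr1 //.
rewrite /star (@Rge0_floorE _ h n) ?(@Rge0_ceilE _ h n) ?nh ?hn ?ltW //.
Qed.

Lemma star_dist p (n : nat) h h' :
  n%:R <= rval h <= n.+1%:R -> n%:R <= rval h' <= n.+1%:R ->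
  mdist (star u p h) (star u p h') = a p n * `|rval h - rval h'|.
Proof.
move=> hn h'n; rewrite !(@star_segment p n) //.
have [_ _ ud] := uP (p (nat_Rge0 n)) (p (nat_Rge0 n.+1)).
have a0 : 0 <= a p n by apply: mdist_ge0.
have segP k : n%:R <= rval k <= n.+1%:R ->
    a p n * (rval k - n%:R) \in `[0, mdist (p (nat_Rge0 n)) (p (nat_Rge0 n.+1))].
  rewrite -(natr1 n) => kn; rewrite in_itv /= -/(a p n); apply/andP; split; nra.
rewrite ud ?segP // -mulrBr normrM ger0_norm //.
by congr (_ * `| _ |); ring.
Qed.

Lemma star_near p (n : nat) h : n%:R <= rval h <= n.+1%:R ->
  mdist (p (nat_Rge0 n)) (star u p h) <= a p n.
Proof.
move=> hn; rewrite -(star_nat p n) (@star_dist p n) // ?to_Rge0K; last first.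
  by rewrite lexx ler_nat /=.
have a0 : 0 <= a p n by apply: mdist_ge0.
rewrite distrC ger0_norm ?subr_ge0; last by case/andP: hn.
by move: hn; rewrite -(natr1 n) => hn; nra.
Qed.

Lemma star_continuous p : continuous (star u p).
Proof.
apply/continuous_Rge0P => h e e0.
have a0 n : 0 <= a p n by apply: mdist_ge0.
pose n := Num.truncn (rval h).
pose L := a p n.-1 + a p n + a p n.+1 + 1.
have L0 : 0 < L by have := a0 n.-1; have := a0 n; have := a0 n.+1; rewrite /L; lra.
have aL m : (n.-1 <= m <= n.+1)%N -> a p m <= L.
  have := a0 n.-1; have := a0 n; have := a0 n.+1; rewrite /L => ? ? ?.
  rewrite leq_eqVlt => /andP[/predU1P[<- _|nm]]; first by lra.
  rewrite leq_eqVlt => /predU1P[->|mn]; first by lra.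
  have -> : m = n by lia.
  lra.
have close (k k' : Rge0 R) m m' : rval k <= rval k' -> rval k' - rval k < 1 ->
    m%:R <= rval k < m.+1%:R -> m'%:R <= rval k' < m'.+1%:R ->
    a p m <= L -> a p m' <= L ->
    mdist (star u p k) (star u p k') <= L * (rval k' - rval k).
  move=> kk' kk'1 km k'm' am am'.
  have mm' : (m <= m')%N.
    rewrite -ltnS -(ltr_nat R); lra.
  move: mm'; rewrite leq_eqVlt => /predU1P[mm'|mm'].
    subst m'; rewrite (@star_dist p m); [|lra|lra].
    rewrite distrC ger0_norm; last by lra.
    by rewrite ler_wpM2r //; lra.
  have m'E : m' = m.+1.
    apply/eqP; rewrite eqn_leq mm' andbT -ltnS -(ltr_nat R).
    by move: km k'm'; rewrite -!natr1; lra.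
  subst m'; apply: (le_trans (metric_triangle _ (star u p (nat_Rge0 m.+1)) _)).
  rewrite (@star_dist p m) ?to_Rge0K ?lexx ?ler_nat ?leqnSn; [|lra|by []].
  rewrite (@star_dist p m.+1) ?to_Rge0K ?lexx ?ler_nat ?leqnSn; [|by []|lra].
  rewrite (distrC (rval k)) (distrC m.+1%:R (rval k')) !ger0_norm; [|lra..].
  have -> : L * (rval k' - rval k) =
            L * (m.+1%:R - rval k) + L * (rval k' - m.+1%:R) by ring.
  by apply: lerD; rewrite ler_wpM2r //; lra.
exists (Num.min 1 (e / L)); first by rewrite lt_min ltr01 divr_gt0.
move=> h'; rewrite lt_min ltr_pdivlMr // mulrC => /andP[hh'1 hh'e].
have hn := truncP h; have h'n := truncP h'; rewrite -/n in hn.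
have n'n : (n.-1 <= Num.truncn (rval h') <= n.+1)%N.
  move: hn h'n hh'1; set n' := Num.truncn (rval h') => hn h'n.
  rewrite ltr_norml => hh'1.
  have : (n < n'.+2)%N by rewrite -(ltr_nat R) -natr1; lra.
  have : (n' < n.+2)%N by rewrite -(ltr_nat R) -natr1; lra.
  by lia.
have an : a p n <= L by apply: aL; lia.
have an' := aL _ n'n.
apply: le_lt_trans hh'e.
have [hh'|h'h] := leP (rval h) (rval h').
  rewrite distrC ger0_norm; last by lra.
  apply: close hn h'n an an' => //.
  by move: hh'1; rewrite distrC ger0_norm //; lra.
rewrite ger0_norm; last by lra.
rewrite metric_sym; apply: close h'n hn an' an; first exact: ltW.
by move: hh'1; rewrite ger0_norm //; lra.
Qed.

End star_theory.

Section coarse_theory.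
Context {R : realType}.
Implicit Types X Y Z : metricType R.

Lemma mbounded_near X (B : set X) (K : R) : mbounded B ->
  mbounded [set y | exists2 x, B x & mdist x y <= K].
Proof.
move=> [M BM]; exists (K + M + K) => y y' [x Bx xy] [x' Bx' xy'].
apply: (le_trans (metric_triangle _ x' _)).
apply: (le_trans (lerD (metric_triangle _ x _) (lexx _))).
by rewrite metric_sym in xy; rewrite !lerD // BM.
Qed.

Lemma coarse_near X Y (f g : X -> Y) (K : R) :
  coarse f -> (forall x, mdist (f x) (g x) <= K) -> coarse g.
Proof.
move=> [fc fp] fg.
have [|K0] := ltP K 0.
  move=> K0; split.
    move=> r r0; exists 1 => // x; have := fg x.
    by have := mdist_ge0 (f x) (g x); lra.
  move=> B _; exists 0 => x; have := fg x.
  by have := mdist_ge0 (f x) (g x); lra.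
split.
  move=> r r0; have [s s0 fs] := fc r r0.
  exists (K + s + K); first by lra.
  move=> x y xy; apply: (le_lt_trans (metric_triangle _ (f y) _)).
  rewrite ltr_leD //.
  apply: (le_lt_trans (metric_triangle _ (f x) _)).
  by rewrite ler_ltD ?fs // metric_sym.
move=> B /(@mbounded_near _ _ K)/fp[M BM]; exists M => x y Bx By.
by apply: BM; [exists (g x)|exists (g y)] => //; rewrite metric_sym.
Qed.

Lemma coarse_id X : coarse (@id X).
Proof. by split=> // r r0; exists r. Qed.

Lemma coarse_comp X Y Z (g : Y -> Z) (f : X -> Y) :
  coarse g -> coarse f -> coarse (g \o f).
Proof.
move=> [gc gp] [fc fp]; split=> [r r0|B /gp/fp //].
have [s s0 fs] := fc r r0; have [t t0 gs] := gc s s0.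
by exists t => // x y /fs/gs.
Qed.

Lemma star_coarse X (u : X -> X -> R -> X) (p : Rge0 R -> X) :
  geodesic_choice u -> coarse p -> coarse (star u p).
Proof.
move=> uP pc; have [pc1 _] := pc.
have [s s0 ps] := pc1 2 ltac:(by []).
apply: (@coarse_near _ _ _ _ (s + s) pc) => h.
pose n := Num.truncn (rval h).
have hn : n%:R <= rval h < n.+1%:R by apply/truncn_itv/Rge0_ge0.
apply: (le_trans (metric_triangle _ (p (nat_Rge0 n)) _)).
apply: lerD.
  apply/ltW/ps; rewrite mdist_Rge0 to_Rge0K ger0_norm; last by lra.
  by move: hn; rewrite -natr1; lra.
apply: (le_trans (star_near uP _ _)); first by lra.
apply/ltW/ps; rewrite mdist_Rge0 !to_Rge0K -(natr1 n).
by rewrite distrC ger0_norm; lra.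
Qed.

Lemma geodesic_choiceP X : geodesic_space X ->
  exists u : X -> X -> R -> X, geodesic_choice u.
Proof.
move=> Xg; exists (fun x y => sval (cid (Xg x y))) => x y; exact: svalP.
Qed.

Lemma coarse_path_joined X Y (f : X -> Y) : geodesic_space Y -> coarse f ->
  forall B : set Y, mbounded B -> exists2 A : set X, mbounded A &
    f @^-1` B `<=` A /\
    forall x y, path_joined (~` A) x y -> path_joined (~` B) (f x) (f y).
Proof.
move=> Yg [fc fp] B bB; have [s s0 fs] := fc 1 ltr01.
pose B' : set Y := [set y | exists2 x, B x & mdist x y <= s].
exists (f @^-1` B'); first exact/fp/mbounded_near.
split=> [x Bfx|x y [g [gc gA <- <-]]].
  by exists (f x) => //; rewrite mdistxx ltW.
have [d d0 gd] := segment_unif_continuous gc ltr01.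
have gnB t : t \in `[(0 : R), 1] -> ~ B' (f (g t)).
  by move=> t01; apply: gA; exists t.
have step x1 x2 : ~ B' (f x1) -> mdist x1 x2 < 1 ->
    path_joined (~` B) (f x1) (f x2).
  move=> x1B /fs x12; have [v [v0 v1 vd]] := Yg (f x1) (f x2).
  have D0 := mdist_ge0 (f x1) (f x2).
  rewrite -{1}v0 -v1; apply: path_joined_segment => //.
    apply/within_segmentP => t tab e e0; exists e => // t' t'ab tt'.
    by rewrite vd.
  move=> t tD Bvt; apply: x1B; exists (v t) => //.
  rewrite -v0 vd //; last by rewrite in_itv /= lexx.
  by move: tD; rewrite in_itv /= subr0 => /andP[t0 tD]; rewrite ger0_norm //; lra.
pose k := (Num.truncn d^-1).+1.
have k0 : 0 < k%:R :> R by rewrite ltr0n.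
have kd : k%:R^-1 < d.
  by rewrite -[d]invrK ltf_pV2 ?posrE ?invr_gt0 //; apply: truncnS_gt.
have kP i : (i <= k)%N -> i%:R / k%:R \in `[(0 : R), 1].
  move=> ik; rewrite in_itv /= divr_ge0 //=.
  by rewrite ler_pdivrMr // mul1r ler_nat.
suff H i : (i <= k)%N -> path_joined (~` B) (f (g 0)) (f (g (i%:R / k%:R))).
  by have := H k (leqnn k); rewrite divff // gt_eqF.
elim: i => [_|i IH ik].
  rewrite mul0r; apply: path_joined_refl => Bf.
  have /gnB : (0 : R) \in `[(0 : R), 1] by rewrite in_itv /= lexx ler01.
  by apply; exists (f (g 0)) => //; rewrite mdistxx ltW.
apply: (path_joined_trans (IH (ltnW ik))); apply: step.
  exact/gnB/kP/ltnW.
apply: gd; [exact/kP/ltnW|exact: kP|].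
rewrite distrC -mulrBl -(natr1 i) [X in X / _](_ : _ = 1); last by ring.
by rewrite div1r gtr0_norm ?invr_gt0.
Qed.

Lemma coarse_ray_exists X (r : ray X) : geodesic_space X ->
  exists2 r' : ray X, coarse r' & ray_equiv r r'.
Proof.
move=> /geodesic_choiceP[u uP].
have rc := @ray_continuous _ _ r; have rp := @ray_proper _ _ r.
have /choice[d dP] (n : nat) : exists d : R, 0 < d <= 1 /\
    forall s t : R, n%:R <= s <= n%:R + 2 -> n%:R <= t <= n%:R + 2 ->
      `|s - t| <= d -> mdist (r (clamp s)) (r (clamp t)) < 1.
  have [d d0 rd] := segment_unif_continuous
    (@within_clamp _ _ _ n%:R (n%:R + 2) rc (ler0n _ _)) ltr01.
  exists (Num.min 1 (d / 2)); split.
    by rewrite lt_min ltr01 divr_gt0 //= ge_min lexx.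
  move=> s t sn tn; rewrite le_min => /andP[_ st].
  by apply: rd; rewrite ?in_itv //; lra.
pose s := fix s (j : nat) : R :=
  if j is i.+1 then s i + d (Num.truncn (s i)) else 0.
have d0 n : 0 < d n <= 1 by have [] := dP n.
have s0 j : 0 <= s j.
  elim: j => [|j IH] //=; have := d0 (Num.truncn (s j)); lra.
have smono i j : (i <= j)%N -> s i <= s j.
  elim: j => [|j IH]; first by rewrite leqn0 => /eqP ->.
  rewrite leq_eqVlt => /predU1P[-> //|/IH ij] /=.
  have := d0 (Num.truncn (s j)); lra.
have sinf (M : nat) : exists j, M%:R <= s j.
  elim: M => [|M [j Mj]]; first by exists 0%N.
  have H i : M.+1%:R <= s (j + i)%N \/ M%:R + i%:R * d M <= s (j + i)%N.
    elim: i => [|i [IH|IH]]; first by right; rewrite addn0 mul0r addr0.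
      by left; rewrite addnS /=; have := d0 (Num.truncn (s (j + i)%N)); lra.
    have [lt|ge] := ltP (s (j + i)%N) M.+1%:R; last first.
      by left; rewrite addnS /=; have := d0 (Num.truncn (s (j + i)%N)); lra.
    right; rewrite addnS /=.
    have -> : Num.truncn (s (j + i)%N) = M.
      apply: truncn_def; rewrite lt andbT.
      by apply: (le_trans Mj); apply/smono/leq_addr.
    by rewrite -natr1; lra.
  have [dM0 _] := andP (d0 M).
  pose i := (Num.truncn (d M)^-1).+1.
  exists (j + i)%N; have [//|] := H i; apply: le_trans.
  rewrite -natr1 lerD2l -ler_pdivrMr // div1r ltW //; exact: truncnS_gt.
pose x (j : nat) : X := r (clamp (s j)).
have xstep j : mdist (x j) (x j.+1) < 1.
  have dn := d0 (Num.truncn (s j)).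
  have [_] := dP (Num.truncn (s j)); apply => /=.
  - by have := truncn_itv (s0 j); rewrite -natr1; lra.
  - by have := truncn_itv (s0 j); rewrite -natr1; lra.
  - by rewrite distrC addrAC subrr add0r ger0_norm; lra.
have xdist i k : mdist (x i) (x (i + k)%N) <= k%:R.
  elim: k => [|k IH]; first by rewrite addn0 mdistxx.
  apply: (le_trans (metric_triangle _ (x (i + k)%N) _)).
  by rewrite -natr1 lerD // addnS ltW.
pose p (h : Rge0 R) : X := x (Num.truncn (rval h)).
have xdist' (h h' : Rge0 R) : rval h <= rval h' ->
    mdist (p h) (p h') <= rval h' - rval h + 1.
  move=> hh'; have nn' := le_truncn hh'.
  have := xdist (Num.truncn (rval h)) (Num.truncn (rval h') - Num.truncn (rval h))%N.
  rewrite subnKC // natrB //.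
  have := truncn_itv (Rge0_ge0 h); have := truncn_itv (Rge0_ge0 h').
  by rewrite -!natr1 /p; lra.
have xB (B : set X) : mbounded B -> exists J : nat, forall j, (J <= j)%N ->
    forall h, s j <= rval h -> ~ B (r h).
  move=> /(metrically_proper_tail rp)[n nB].
  have [J nJ] := sinf n; exists J => j Jj h sh; apply: nB.
  by apply: le_trans sh; apply: (le_trans nJ); apply: smono.
have pc : coarse p.
  split.
    move=> e e0; exists (e + 1); first by lra.
    move=> h h'; rewrite mdist_Rge0 => hh'.
    have [le|/ltW le] := leP (rval h) (rval h').
      apply: (le_lt_trans (xdist' _ _ le)).
      by move: hh'; rewrite distrC ger0_norm; lra.
    rewrite metric_sym; apply: (le_lt_trans (xdist' _ _ le)).
    by move: hh'; rewrite ger0_norm; lra.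
  apply: tail_metrically_proper => B /xB[J JB]; exists J => h Jh.
  apply: (JB (Num.truncn (rval h))); last by rewrite clampE.
  by rewrite truncn_ge_nat // Rge0_ge0.
have qc := star_coarse uP pc.
exists (Ray (@star_continuous _ _ u uP p) qc.2) => //=.
apply: ray_equivP => B bB; have [J JB] := xB _ bB.
have [n nB] := metrically_proper_tail qc.2 bB.
pose j := maxn J n.
exists (clamp (s j)), (nat_Rge0 j); split=> /=.
- by move=> k; rewrite clampE //; apply: JB; rewrite leq_maxl.
- move=> k; rewrite to_Rge0K => jk; apply: nB; apply: le_trans jk.
  by rewrite ler_nat leq_maxr.
- rewrite star_nat // /p to_Rge0K natrK; apply: path_joined_refl.
  by apply: (JB j); rewrite ?leq_maxl ?clampE.
Qed.

End coarse_theory.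

Section ends.
Context {R : realType} (X : metricType R).

Definition ray_equivb (r r' : ray X) : bool := `[< ray_equiv r r' >].

Let ray_equivb_refl : reflexive ray_equivb.
Proof. by move=> r; apply/asboolP/ray_equiv_refl. Qed.

Let ray_equivb_sym : symmetric ray_equivb.
Proof.
by move=> r r'; apply/idP/idP => /asboolP rr'; apply/asboolP/ray_equiv_sym.
Qed.

Let ray_equivb_trans : transitive ray_equivb.
Proof.
move=> r' r r'' /asboolP rr' /asboolP r'r''; apply/asboolP.
exact: ray_equiv_trans rr' r'r''.
Qed.

Canonical ray_equiv_rel :=
  EquivRel ray_equivb ray_equivb_refl ray_equivb_sym ray_equivb_trans.

Definition Ends : Type := {eq_quot ray_equiv_rel}.

Definition end_of (r : ray X) : Ends := \pi r.

Lemma end_ofP (r r' : ray X) : end_of r = end_of r' <-> ray_equiv r r'.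
Proof.
split=> [/eqmodP /asboolP //|rr']; apply/eqmodP; exact/asboolP.
Qed.

Lemma end_of_surj (e : Ends) : exists r, end_of r = e.
Proof. by exists (repr e); apply: reprK. Qed.

Lemma end_of_coarse_surj (e : Ends) : geodesic_space X ->
  exists2 r : ray X, coarse r & end_of r = e.
Proof.
move=> Xg; have [r <-] := end_of_surj e.
have [r' r'c rr'] := coarse_ray_exists r Xg.
by exists r' => //; apply/end_ofP/ray_equiv_sym.
Qed.

End ends.

Definition star_ray (R : realType) (X : metricType R) (u : X -> X -> R -> X)
    (uP : geodesic_choice u) (p : Rge0 R -> X) (pc : coarse p) : ray X :=
  Ray (star_continuous uP (p := p)) (star_coarse uP pc).2.

Section ends_map.
Context {R : realType}.
Implicit Types X Y Z : pgeoType R.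

Definition coarse_rep X (e : Ends X) : ray X :=
  s2val (cid2 (end_of_coarse_surj e (@pgeo_geodesic R X))).

Lemma coarse_rep_coarse X (e : Ends X) : coarse (coarse_rep e).
Proof. by rewrite /coarse_rep; case: cid2. Qed.

Lemma coarse_repK X (e : Ends X) : end_of (coarse_rep e) = e.
Proof. by rewrite /coarse_rep; case: cid2. Qed.

Definition geodesics X (x y : X) : R -> X :=
  sval (cid (@pgeo_geodesic R X x y)).

Lemma geodesicsP X : geodesic_choice (@geodesics X).
Proof. by move=> x y; apply: svalP. Qed.

(* The rule [end r |-> end ((f \o r)^* )] presupposes that [(f \o r)^*] is
   metrically proper. This holds when [r] is coarse, but fails for some rays
   [r]: already for [f = id] in the plane, when [r n] and [r n.+1] are far away
   on opposite sides of the origin. We therefore evaluate the rule on a coarse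
   representative; [ends_mapE] below shows that the rule then holds for every
   choice of geodesics and every ray [r] such that [(f \o r)^*] is again a
   ray. *)
Definition ends_map X Y (f : coarseMap X Y) (e : Ends X) : Ends Y :=
  end_of (star_ray (@geodesicsP Y)
    (coarse_comp (coarse_funP f) (coarse_rep_coarse e))).

Lemma star_ray_equiv X Y (f : coarseMap X Y) (u1 u2 : Y -> Y -> R -> Y)
    (r1 r2 : ray X) (r1' r2' : ray Y) :
  geodesic_choice u1 -> geodesic_choice u2 ->
  r1' =1 star u1 (f \o r1) -> r2' =1 star u2 (f \o r2) ->
  ray_equiv r1 r2 -> ray_equiv r1' r2'.
Proof.
move=> u1P u2P r1E r2E /ray_equiv_joined r12; apply: ray_equivP => B bB.
have [A bA [_ AB]] := coarse_path_joined (@pgeo_geodesic R Y) (coarse_funP f) bB.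
have [n nA] := r12 _ bA.
have [n1 n1B] := metrically_proper_tail (@ray_proper _ _ r1') bB.
have [n2 n2B] := metrically_proper_tail (@ray_proper _ _ r2') bB.
pose N := maxn n (maxn n1 n2).
have NP m : (m <= N)%N -> m%:R <= rval (@nat_Rge0 R N).
  by rewrite to_Rge0K ler_nat.
have nN : (n <= N)%N by rewrite leq_maxl.
have n1N : (n1 <= N)%N by rewrite leq_max leq_maxl orbT.
have n2N : (n2 <= N)%N by rewrite leq_max leq_maxr orbT.
exists (nat_Rge0 N), (nat_Rge0 N); split.
- by move=> k Nk; apply: n1B; apply: le_trans Nk; apply: NP.
- by move=> k Nk; apply: n2B; apply: le_trans Nk; apply: NP.
- by rewrite r1E r2E !star_nat //; apply/AB/nA; apply: NP.
Qed.

Lemma ends_mapE X Y (f : coarseMap X Y) (u : Y -> Y -> R -> Y)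
    (r : ray X) (r' : ray Y) :
  geodesic_choice u -> r' =1 star u (f \o r) ->
  ends_map f (end_of r) = end_of r'.
Proof.
move=> uP r'E; apply/end_ofP.
apply: star_ray_equiv (@geodesicsP Y) uP _ r'E _ => //.
by apply/end_ofP; rewrite coarse_repK.
Qed.

Definition coarseMap_id X : coarseMap X X := CoarseMap (@coarse_id R X).

Definition coarseMap_comp X Y Z (g : coarseMap Y Z) (f : coarseMap X Y) :
    coarseMap X Z :=
  CoarseMap (coarse_comp (coarse_funP g) (coarse_funP f)).

Lemma ends_map_id X : ends_map (coarseMap_id X) = id.
Proof.
apply/funext => e; rewrite -[RHS]coarse_repK; apply/end_ofP.
set r := coarse_rep e; set r' := star_ray _ _.
apply: ray_equivP => B bB.
have [n nB] := metrically_proper_tail (@ray_proper _ _ r) bB.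
have [n' n'B] := metrically_proper_tail (@ray_proper _ _ r') bB.
pose N := @nat_Rge0 R (maxn n n').
have nN : n%:R <= rval N by rewrite to_Rge0K ler_nat leq_maxl.
have n'N : n'%:R <= rval N by rewrite to_Rge0K ler_nat leq_maxr.
exists N, N; split.
- by move=> k Nk; apply: n'B; apply: le_trans Nk.
- by move=> k Nk; apply: nB; apply: le_trans Nk.
- have -> : r' N = r N by exact: (star_nat (@geodesicsP X)).
  exact/path_joined_refl/nB.
Qed.

Lemma ends_map_comp X Y Z (g : coarseMap Y Z) (f : coarseMap X Y) :
  ends_map (coarseMap_comp g f) = ends_map g \o ends_map f.
Proof.
apply/funext => e; apply/esym; apply: (ends_mapE (@geodesicsP Z)) => h.
have [n nE] := Rge0_floor_is_nat h; have [m mE] := Rge0_ceil_is_nat h.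
have E k : star_ray (@geodesicsP Y) (coarse_comp (coarse_funP f)
    (coarse_rep_coarse e)) (nat_Rge0 k) = f (coarse_rep e (nat_Rge0 k)).
  exact: (star_nat (@geodesicsP Y)).
by rewrite [LHS]/= /star nE mE [in RHS]/comp !E.
Qed.

End ends_map.

Section coarse_homotopy.
Context {R : realType}.
Implicit Types X Y : metricType R.

(* The type [cylinder q] carries the restriction of the max metric. *)
Definition cylinder X (q : X -> Rge0 R) : Type :=
  set_type [set z : X * Rge0 R | rval z.2 <= rval (q z.1)].

Definition Rge0_zero : Rge0 R := to_Rge0 (lexx 0).

Definition cylinder_bottom X (q : X -> Rge0 R) (x : X) : cylinder q :=
  exist _ (x, Rge0_zero) (mem_set (Rge0_ge0 (q x))).

Definition cylinder_top X (q : X -> Rge0 R) (x : X) : cylinder q :=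
  exist _ (x, q x) (mem_set (lexx (rval (q x)))).

Definition coarse_homotopic X Y (f g : X -> Y) : Prop :=
  exists2 q : X -> Rge0 R, coarse q &
  exists2 H : cylinder q -> Y, coarse H &
    forall x, H (cylinder_bottom q x) = f x /\ H (cylinder_top q x) = g x.

Definition coarse_homotopy_equivalence X Y (f : coarseMap X Y) : Prop :=
  exists g : coarseMap Y X,
    coarse_homotopic (g \o f) id /\ coarse_homotopic (f \o g) id.

End coarse_homotopy.

(* Main.v *)
(* A coarse homotopy H from f to g carries the vertical segment
   {x} x [0, q x] of the cylinder to a chain from f x to g x with bounded
   steps; outside a suitable bounded subset of the cylinder, geodesics turn
   this chain into a path that avoids a given bounded B. The projection of that
   subset to X is bounded, so a proper ray r eventually leaves it, and from then
   on f (r n) and g (r n) are joined outside B. Bijectivity for homotopy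
   equivalences follows by functoriality. *)

Require Import Defs.
From mathcomp Require Import all_boot all_order all_algebra.
From mathcomp Require Import zify.
From mathcomp Require Import all_classical all_reals all_analysis.

Set Implicit Arguments.
Unset Strict Implicit.
Unset Printing Implicit Defensive.

Import Order.TTheory GRing.Theory Num.Theory.

Local Open Scope classical_set_scope.
Local Open Scope ring_scope.

Section cylinder_theory.
Context {R : realType} {X : metricType R} (q : X -> Rge0 R).

Lemma mdist_cylinder (z z' : cylinder q) :
  mdist z z' = Num.max (mdist (\val z).1 (\val z').1)
                       `|rval (\val z).2 - rval (\val z').2|.
Proof. by rewrite -mdist_Rge0. Qed.

Lemma cylinder_point_subproof (x : X) (t : R) :
  rval (clamp (Num.min t (rval (q x)))) <= rval (q x).
Proof. by rewrite to_Rge0K ge_max Rge0_ge0 ge_min lexx orbT. Qed.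

(* [t] is truncated to [[0, q x]]. *)
Definition cylinder_point (x : X) (t : R) : cylinder q :=
  exist _ (x, clamp (Num.min t (rval (q x))))
    (mem_set (cylinder_point_subproof x t)).

Lemma cylinder_pointE x t : 0 <= t <= rval (q x) ->
  rval (\val (cylinder_point x t)).2 = t.
Proof. by move=> /andP[t0 tq] /=; rewrite min_l // clampE. Qed.

Lemma cylinder_point0 x : cylinder_point x 0 = cylinder_bottom q x.
Proof.
apply: val_inj; congr pair; apply: rval_inj.
by rewrite min_l ?Rge0_ge0 // clampE.
Qed.

Lemma cylinder_point_top x : cylinder_point x (rval (q x)) = cylinder_top q x.
Proof. by apply: val_inj; congr pair; rewrite minxx clampK. Qed.

(** The path is [cylinder_point x] on [[0, q x]]; it is isometric for the max metric, so [e] itself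
    serves as the modulus of continuity. *)
Lemma path_joined_cylinder (A : set (cylinder q)) x :
  (forall z, (\val z).1 = x -> ~ A z) ->
  path_joined (~` A) (cylinder_bottom q x) (cylinder_top q x).
Proof.
move=> xA; rewrite -cylinder_point0 -cylinder_point_top.
apply: path_joined_segment (Rge0_ge0 _) _ _ => [|t _]; last exact: xA.
apply/within_segmentP => s sq e e0; exists e => // t tq st.
by rewrite mdist_cylinder !cylinder_pointE //= mdistxx gt_max e0.
Qed.

Lemma mbounded_cylinder_proj (A : set (cylinder q)) :
  mbounded A -> mbounded [set (\val z).1 | z in A].
Proof.
move=> [M AM]; exists M => _ _ [z Az <-] [z' Az' <-].
by apply: le_trans (AM _ _ Az Az'); rewrite mdist_cylinder le_max lexx.
Qed.

End cylinder_theory.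

Lemma coarse_homotopic_joined (R : realType) (X Y : metricType R)
    (f g : X -> Y) : geodesic_space Y -> coarse_homotopic f g ->
  forall B : set Y, mbounded B -> exists2 A : set X, mbounded A &
    forall x, ~ A x -> path_joined (~` B) (f x) (g x).
Proof.
move=> Yg [q _ [H Hc HE]] B bB.
have [A bA [_ AB]] := coarse_path_joined Yg Hc bB.
exists [set (\val z).1 | z in A]; first exact: mbounded_cylinder_proj.
(* Since [x] lies outside the projection of [A], the whole fibre over [x] misses [A]. *)
move=> x xA; have [<- <-] := HE x; apply: AB; apply: path_joined_cylinder.
by move=> z zx Az; apply: xA; exists z.
Qed.

Lemma ends_map_coarse_homotopic (R : realType) (X Y : pgeoType R)
    (f g : coarseMap X Y) : coarse_homotopic f g -> ends_map f = ends_map g.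
Proof.
move=> fg; apply/funext => e; apply/end_ofP; set r1 := star_ray _ _.
set r2 := star_ray _ _; apply: ray_equivP => B bB.
have [A bA AB] := coarse_homotopic_joined (@pgeo_geodesic R Y) fg bB.
have [n nA] := metrically_proper_tail (@ray_proper _ _ (coarse_rep e)) bA.
have [n1 n1B] := metrically_proper_tail (@ray_proper _ _ r1) bB.
have [n2 n2B] := metrically_proper_tail (@ray_proper _ _ r2) bB.
(* Past [n] the representative avoids [A]; past [n1] and [n2] the two image rays avoid [B]. *)
pose N := maxn n (maxn n1 n2).
have NP m : (m <= N)%N -> m%:R <= rval (@nat_Rge0 R N).
  by rewrite to_Rge0K ler_nat.
exists (nat_Rge0 N), (nat_Rge0 N); split.
- by move=> k Nk; apply: n1B; apply: le_trans Nk; apply: NP; rewrite /N; lia.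
- by move=> k Nk; apply: n2B; apply: le_trans Nk; apply: NP; rewrite /N; lia.
(* At the integer [N] both rays take the values of [f] and [g] at the same point of
   [coarse_rep e]. *)
- rewrite [r1 _](star_nat (@geodesicsP R Y)) [r2 _](star_nat (@geodesicsP R Y)).
  by apply/AB/nA/NP; rewrite leq_maxl.
Qed.

Theorem corollary7p5 (R : realType) :
  (forall (X Y : pgeoType R) (f g : coarseMap X Y),
     coarse_homotopic f g -> ends_map f = ends_map g) /\
  (forall (X Y : pgeoType R) (f : coarseMap X Y),
     coarse_homotopy_equivalence f -> bijective (ends_map f)).
Proof.
split=> [|X Y f [g [gf fg]]]; first exact: ends_map_coarse_homotopic.
exists (ends_map g) => e.
  (* Refolding as a composite turns the goal into one about [g \o f], which is homotopic to the
     identity. *)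
  rewrite -[LHS]/((ends_map g \o ends_map f) e) -ends_map_comp.
  by rewrite (@ends_map_coarse_homotopic _ _ _ _ (coarseMap_id X)) // ends_map_id.
rewrite -[LHS]/((ends_map f \o ends_map g) e) -ends_map_comp.
by rewrite (@ends_map_coarse_homotopic _ _ _ _ (coarseMap_id Y)) // ends_map_id.
Qed.
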